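(* Let $K$ be a field and let $I\subset S=K[x_1,\ldots,x_n]$ be a nonzero proper monomial ideal with primary irredundant decomposition $I=Q_1\cap\cdots\cap Q_k$ into monomial ideals. Let $P_j=\sqrt{Q_j}$, let $q_j=\operatorname{sdepth}_S(Q_j)$ and let $d_j=|P_j|$ be the number of variables generating $P_j$, numbered so that $d_1\ge d_2\ge\cdots\ge d_k$. Then: (1) $n-\left\lfloor d_1/2\right\rfloor\ \ge\ \operatorname{sdepth}_S(I)\ \ge\ q_1+\cdots+q_k-n(k-1)$. (2) $n-d_1\ \ge\ \operatorname{sdepth}_S(S/I)\ \ge\ \min\{n-d_1,\ q_1-d_2,\ q_1+q_2-d_3-n,\ \ldots,\ q_1+\cdots+q_{k-1}-d_k-n(k-2)\}$. (For $1\le i\le k$, the $i$-th term in the minimum in (2) is $q_1+\cdots+q_{i-1}-d_i-n(i-2)$.)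
   Context: Let $S=K[x_1,\ldots,x_n]$ with its $\mathbb Z^n$-grading, and let $M\neq 0$ be a finitely generated $\mathbb Z^n$-graded $S$-module. A Stanley decomposition of $M$ is a finite direct sum decomposition of $K$-vector spaces $\mathcal D: M=\bigoplus_{i=1}^t m_iK[Z_i]$, where the $m_i\in M$ are homogeneous, $Z_i\subset\{x_1,\ldots,x_n\}$, and each $m_iK[Z_i]$ is a free $K[Z_i]$-module. Put $\operatorname{sdepth}(\mathcal D)=\min_i|Z_i|$, and let $\operatorname{sdepth}_S(M)$ be the maximum of $\operatorname{sdepth}(\mathcal D)$ over all Stanley decompositions of $M$. In the irredundant primary decomposition, the $Q_j$ are primary monomial ideals with pairwise distinct radicals $P_j$, none of which can be omitted; so $\operatorname{Ass}(S/I)=\{P_1,\ldots,P_k\}$, and each $P_j$ is generated by variables. *)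

(* Defs.v *)
From HB Require Import structures.
From mathcomp Require Import all_boot all_order all_algebra.
From mathcomp Require Import generic_quotient ring_quotient.
From mathcomp Require Import boolp.
From mathcomp Require Export mpoly.

Set Implicit Arguments.
Unset Strict Implicit.
Unset Printing Implicit Defensive.

Import GRing.Theory.
Local Open Scope ring_scope.
Local Open Scope quotient_scope.

Section IdealModules.
Variables (R : comNzRingType) (I : idealr R).

Definition ideal_sub : Type := {x : R | x \in I}.

HB.instance Definition _ := [isSub of ideal_sub for (@sval R (fun x => x \in I))].
HB.instance Definition _ := [Choice of ideal_sub by <:].
HB.instance Definition _ := [SubChoice_isSubZmodule of ideal_sub by <:].

Definition ideal_scale (a : R) (x : ideal_sub) : ideal_sub :=
  exist _ (a * val x) (idealMr a (valP x)).

Fact ideal_scaleA a b x : ideal_scale a (ideal_scale b x) = ideal_scale (a * b) x.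
Proof. by apply/val_inj; rewrite /= mulrA. Qed.
Fact ideal_scale1 : left_id 1 ideal_scale.
Proof. by move=> x; apply/val_inj; rewrite /= mul1r. Qed.
Fact ideal_scaleDr : right_distributive ideal_scale +%R.
Proof. by move=> a x y; apply/val_inj; rewrite /= mulrDr. Qed.
Fact ideal_scaleDl x : {morph ideal_scale^~ x : a b / a + b}.
Proof. by move=> a b; apply/val_inj; rewrite /= mulrDl. Qed.

HB.instance Definition _ := GRing.Zmodule_isLmodule.Build R ideal_sub
  ideal_scaleA ideal_scale1 ideal_scaleDr ideal_scaleDl.

Definition quot_sub : Type := {ideal_quot I}.
HB.instance Definition _ := GRing.ComNzRing.on quot_sub.

Definition quot_pi : R -> quot_sub := \pi_({ideal_quot I}).

Fact quot_pi_is_zmod_morphism : zmod_morphism quot_pi.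
Proof. exact: rmorphB. Qed.
Fact quot_pi_is_monoid_morphism : monoid_morphism quot_pi.
Proof. by split; [exact: rmorph1 | exact: rmorphM]. Qed.
HB.instance Definition _ :=
  GRing.isZmodMorphism.Build R quot_sub quot_pi quot_pi_is_zmod_morphism.
HB.instance Definition _ :=
  GRing.isMonoidMorphism.Build R quot_sub quot_pi quot_pi_is_monoid_morphism.

Definition quot_scale (a : R) (x : quot_sub) : quot_sub := quot_pi a * x.

Fact quot_scaleA a b x : quot_scale a (quot_scale b x) = quot_scale (a * b) x.
Proof. by rewrite /quot_scale rmorphM mulrA. Qed.
Fact quot_scale1 : left_id 1 quot_scale.
Proof. by move=> x; rewrite /quot_scale rmorph1 mul1r. Qed.
Fact quot_scaleDr : right_distributive quot_scale +%R.
Proof. by move=> a x y; rewrite /quot_scale mulrDr. Qed.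
Fact quot_scaleDl x : {morph quot_scale^~ x : a b / a + b}.
Proof. by move=> a b; rewrite /quot_scale rmorphD mulrDl. Qed.

HB.instance Definition _ := GRing.Zmodule_isLmodule.Build R quot_sub
  quot_scaleA quot_scale1 quot_scaleDr quot_scaleDl.

Lemma quot_pi_eq0 f : (quot_pi f == 0) = (f \in I).
Proof. by rewrite -(rmorph0 quot_pi) -[LHS]Quotient.idealrBE subr0. Qed.

Lemma quot_pi_surj x : exists f, x = quot_pi f.
Proof. by exists (repr (x : {ideal_quot I})); rewrite /quot_pi reprK. Qed.

End IdealModules.

Definition zdeg n (a : 'X_{1..n}) : {ffun 'I_n -> int} := [ffun i => (a i)%:Z].

(* The last two fields say that the module is the direct sum of its components
   gm_comp a.  Finite generation and nontriviality are not required here. *)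
Record gradedModule (K : fieldType) (n : nat) := GradedModule {
  gm_sort :> lmodType {mpoly K[n]};
  gm_comp : {ffun 'I_n -> int} -> gm_sort -> Prop;
  gm_comp0 : forall a, gm_comp a 0;
  gm_compD : forall a x y, gm_comp a x -> gm_comp a y -> gm_comp a (x + y);
  gm_compZ : forall a (c : K) x, gm_comp a x -> gm_comp a (c%:MP *: x);
  gm_compX : forall a (b : 'X_{1..n}) x,
    gm_comp a x -> gm_comp (zdeg b + a) ('X_[b] *: x);
  gm_span : forall x, exists (s : seq {ffun 'I_n -> int})
      (y : {ffun 'I_n -> int} -> gm_sort),
    (forall a, gm_comp a (y a)) /\ x = \sum_(a <- s) y a;
  gm_direct : forall (s : seq {ffun 'I_n -> int})
      (y : {ffun 'I_n -> int} -> gm_sort),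
    uniq s -> (forall a, gm_comp a (y a)) -> \sum_(a <- s) y a = 0 ->
    forall a, a \in s -> y a = 0
}.

Section StanleyDepth.
Variables (K : fieldType) (n : nat) (M : gradedModule K n).

Definition homogeneous (x : M) : Prop := exists a, gm_comp a x.

Definition in_subring (Z : {set 'I_n}) (p : {mpoly K[n]}) : bool :=
  all (fun a : 'X_{1..n} => [forall i, (i \notin Z) ==> (a i == 0%N)]) (msupp p).

Definition stanley_space (m : M) (Z : {set 'I_n}) (x : M) : Prop :=
  exists2 p, in_subring Z p & x = p *: m.

(* The cyclic module m K[Z] is free with basis m.  A zero summand, which is free
   of rank 0, is excluded; it could only lower the minimum in sdepth_of. *)
Definition stanley_free (m : M) (Z : {set 'I_n}) : Prop :=
  forall p, in_subring Z p -> p *: m = 0 -> p = 0.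

Definition stanley_decomposition t (m : 'I_t -> M) (Z : 'I_t -> {set 'I_n}) :=
  [/\ forall i, homogeneous (m i),
      forall i, stanley_free (m i) (Z i) &
      forall x : M, exists! y : {ffun 'I_t -> M},
        (forall i, stanley_space (m i) (Z i) (y i)) /\ x = \sum_i y i].

(* The default value n of the minimum is harmless, as #|Z i| <= n; it is only
   attained vacuously for t = 0, that is for M = 0. *)
Definition sdepth_of t (Z : 'I_t -> {set 'I_n}) : nat :=
  \big[minn/n]_(i < t) #|Z i|.

(* All values sdepth_of Z are at most n, so that this maximum ranges over all
   Stanley decompositions of M; it is 0 if there is none, which does not happen
   for finitely generated M. *)
Definition sdepth : nat :=
  \max_(d < n.+1 | `[< exists t (m : 'I_t -> M) (Z : 'I_t -> {set 'I_n}),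
                        stanley_decomposition m Z /\ sdepth_of Z = d >]) d.

Lemma sdepth_ge t (m : 'I_t -> M) (Z : 'I_t -> {set 'I_n}) :
  stanley_decomposition m Z -> (sdepth_of Z <= sdepth)%N.
Proof.
move=> hD; have h : (sdepth_of Z < n.+1)%N.
  rewrite ltnS /sdepth_of; elim/big_rec: _ => // i d _ hd.
  by rewrite geq_min hd orbT.
apply: (@leq_bigmax_cond _ _ (fun d : 'I_n.+1 => d : nat) (Ordinal h)).
by apply/asboolP; exists t, m, Z.
Qed.

End StanleyDepth.

Section MonomialIdeals.
Variables (K : fieldType) (n : nat).
Local Notation S := {mpoly K[n]}.

Definition ideal_generated (G : S -> Prop) (f : S) : Prop :=
  exists s : seq (S * S),
    (forall u, u \in s -> G u.2) /\ f = \sum_(u <- s) u.1 * u.2.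

Definition is_monomial_ideal (I : idealr S) : Prop :=
  exists A : 'X_{1..n} -> Prop, forall f : S,
    (f \in I) <-> ideal_generated (fun g => exists2 a, A a & g = 'X_[a]) f.

(* The library's type idealr consists of proper ideals. *)
Record monomialIdeal := MonomialIdeal {
  mi_ideal :> idealr S;
  mi_monomial : is_monomial_ideal mi_ideal
}.

Lemma monomial_ideal_msupp (I : monomialIdeal) (f : S) a :
  f \in (I : idealr S) -> a \in msupp f -> 'X_[a] \in (I : idealr S).
Proof.
case: (mi_monomial I) => A hA /[dup] fI /hA[s [hs ->]].
rewrite mcoeff_msupp raddf_sum /= => hne.
have [u us hu] : exists2 u, u \in s & (u.1 * u.2)@_a != 0.
  apply/hasP; apply: contraNT hne => /hasPn h.
  by rewrite big_seq big1 // => u /h /negPn/eqP.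
have [b Ab ub] := hs u us.
have bI : 'X_[b] \in (I : idealr S).
  apply/hA; exists [:: (1, 'X_[b])]; split; last by rewrite big_seq1 mul1r.
  by move=> v; rewrite inE => /eqP -> /=; exists b.
move: hu; rewrite ub -mcoeff_msupp (perm_mem (msuppMX _ _)).
by case/mapP => c _ ->; rewrite mpolyXD mulrC idealMr.
Qed.

Definition monomial_comp (a : {ffun 'I_n -> int}) (f : S) : Prop :=
  forall b, b \in msupp f -> zdeg b = a.

Lemma zdeg_inj : injective (@zdeg n).
Proof. by move=> a b /ffunP h; apply/mnmP => i; move: (h i); rewrite !ffunE => -[]. Qed.

Definition monomial_part (a : {ffun 'I_n -> int}) (f : S) : S :=
  \sum_(b <- msupp f | zdeg b == a) f@_b *: 'X_[b].

Lemma mcoeff_monomial_part a f b :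
  (monomial_part a f)@_b = if zdeg b == a then f@_b else 0.
Proof.
rewrite /monomial_part raddf_sum /=.
under eq_bigr do rewrite mcoeffZ mcoeffX.
have [bf|nbf] := boolP (b \in msupp f); last first.
  rewrite memN_msupp_eq0 // if_same big_seq_cond big1 // => c /andP[cf _].
  by case: (c =P b) => [cb|_]; rewrite ?mulr0 //; rewrite -cb cf in nbf.
rewrite big_mkcond (bigD1_seq b) ?msupp_uniq //= eqxx mulr1 big1 ?addr0 // => c /negPf ->.
by rewrite mulr0 if_same.
Qed.

Lemma monomial_partP a f : monomial_comp a (monomial_part a f).
Proof.
move=> b; rewrite mcoeff_msupp mcoeff_monomial_part.
by case: (zdeg b =P a); rewrite ?eqxx.
Qed.

Lemma monomial_part_sum f :
  f = \sum_(a <- map (@zdeg n) (msupp f)) monomial_part a f.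
Proof.
apply/mpolyP => b; rewrite raddf_sum /= big_map.
under eq_bigr do rewrite mcoeff_monomial_part (inj_eq zdeg_inj) eq_sym.
have [bf|nbf] := boolP (b \in msupp f).
  rewrite (bigD1_seq b) ?msupp_uniq //= eqxx big1 ?addr0 // => c /negPf.
  by move=> ->.
by rewrite memN_msupp_eq0 // big1 // => c _; rewrite if_same.
Qed.

Lemma monomial_part_in (I : monomialIdeal) a f :
  f \in (I : idealr S) -> monomial_part a f \in (I : idealr S).
Proof.
move=> fI; rewrite /monomial_part big_seq_cond rpred_sum // => b /andP[bf _].
by rewrite -mul_mpolyC idealMr // (monomial_ideal_msupp fI).
Qed.

Lemma monomial_part_uniq (s : seq {ffun 'I_n -> int}) (y : {ffun 'I_n -> int} -> S) :
  uniq s -> (forall a, monomial_comp a (y a)) ->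
  forall a, a \in s -> monomial_part a (\sum_(b <- s) y b) = y a.
Proof.
move=> us hy a as_; apply/mpolyP => b; rewrite mcoeff_monomial_part raddf_sum /=.
have hz c : zdeg b != c -> (y c)@_b = 0.
  by move=> hc; apply: memN_msupp_eq0; apply: contraNN hc => /hy ->.
case: eqP => [hb|/eqP hb]; last by rewrite hz.
by rewrite (bigD1_seq a) //= big1 ?addr0 // => c hc; rewrite hz // hb eq_sym.
Qed.

Lemma monomial_comp0 a : monomial_comp a 0.
Proof. by move=> b; rewrite msupp0. Qed.

Lemma monomial_compD a f g :
  monomial_comp a f -> monomial_comp a g -> monomial_comp a (f + g).
Proof.
by move=> hf hg b /msuppD_le; rewrite mem_cat => /orP[/hf|/hg].
Qed.

Lemma monomial_compZ a (c : K) f :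
  monomial_comp a f -> monomial_comp a (c%:MP * f).
Proof. by move=> hf b; rewrite mul_mpolyC => /msuppZ_le/hf. Qed.

Lemma monomial_compX a (b : 'X_{1..n}) f :
  monomial_comp a f -> monomial_comp (zdeg b + a) ('X_[b] * f).
Proof.
move=> hf c; rewrite mulrC (perm_mem (msuppMX _ _)) => /mapP[d /hf <- ->].
by apply/ffunP => i; rewrite !ffunE mnmDE PoszD.
Qed.

End MonomialIdeals.

Section GradedModules.
Variables (K : fieldType) (n : nat) (I : monomialIdeal K n).
Local Notation S := {mpoly K[n]}.
Local Notation deg := {ffun 'I_n -> int}.

Definition ideal_comp (a : deg) (x : ideal_sub I) : Prop :=
  monomial_comp a (val x).

Fact ideal_comp0 a : ideal_comp a 0.
Proof. exact: monomial_comp0. Qed.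
Fact ideal_compD a x y : ideal_comp a x -> ideal_comp a y -> ideal_comp a (x + y).
Proof. exact: monomial_compD. Qed.
Fact ideal_compZ a (c : K) x : ideal_comp a x -> ideal_comp a (c%:MP *: x).
Proof. exact: monomial_compZ. Qed.
Fact ideal_compX a (b : 'X_{1..n}) x :
  ideal_comp a x -> ideal_comp (zdeg b + a) ('X_[b] *: x).
Proof. exact: monomial_compX. Qed.

Fact ideal_span (x : ideal_sub I) : exists (s : seq deg) (y : deg -> ideal_sub I),
  (forall a, ideal_comp a (y a)) /\ x = \sum_(a <- s) y a.
Proof.
exists (map (@zdeg n) (msupp (val x))).
exists (fun a => exist _ (monomial_part a (val x)) (monomial_part_in a (valP x))).
split=> [a|]; first exact: monomial_partP.
by apply/val_inj; rewrite raddf_sum /= -monomial_part_sum.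
Qed.

Fact ideal_direct (s : seq deg) (y : deg -> ideal_sub I) :
  uniq s -> (forall a, ideal_comp a (y a)) -> \sum_(a <- s) y a = 0 ->
  forall a, a \in s -> y a = 0.
Proof.
move=> us hy /(congr1 val); rewrite raddf_sum /= => h a as_.
apply/val_inj; rewrite -(@monomial_part_uniq K n s (fun a => val (y a)) us hy a as_) h.
by rewrite /monomial_part msupp0 big_nil.
Qed.

Definition ideal_module : gradedModule K n :=
  GradedModule ideal_comp0 ideal_compD ideal_compZ ideal_compX
    ideal_span ideal_direct.

Definition quot_comp (a : deg) (x : quot_sub I) : Prop :=
  exists2 f, monomial_comp a f & x = quot_pi I f.

Fact quot_comp0 a : quot_comp a 0.
Proof. by exists 0; [exact: monomial_comp0 | rewrite rmorph0]. Qed.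
Fact quot_compD a x y : quot_comp a x -> quot_comp a y -> quot_comp a (x + y).
Proof.
move=> [f hf ->] [g hg ->]; exists (f + g); last by rewrite rmorphD.
exact: monomial_compD.
Qed.
Fact quot_compZ a (c : K) x : quot_comp a x -> quot_comp a (c%:MP *: x).
Proof.
move=> [f hf ->]; exists (c%:MP * f); last by rewrite rmorphM.
exact: monomial_compZ.
Qed.
Fact quot_compX a (b : 'X_{1..n}) x :
  quot_comp a x -> quot_comp (zdeg b + a) ('X_[b] *: x).
Proof.
move=> [f hf ->]; exists ('X_[b] * f); last by rewrite rmorphM.
exact: monomial_compX.
Qed.

Fact quot_span (x : quot_sub I) : exists (s : seq deg) (y : deg -> quot_sub I),
  (forall a, quot_comp a (y a)) /\ x = \sum_(a <- s) y a.
Proof.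
have [f ->] := quot_pi_surj x.
exists (map (@zdeg n) (msupp f)), (fun a => quot_pi I (monomial_part a f)).
split=> [a|]; first by exists (monomial_part a f) => //; exact: monomial_partP.
by rewrite -rmorph_sum /= -monomial_part_sum.
Qed.

Fact quot_direct (s : seq deg) (y : deg -> quot_sub I) :
  uniq s -> (forall a, quot_comp a (y a)) -> \sum_(a <- s) y a = 0 ->
  forall a, a \in s -> y a = 0.
Proof.
move=> us hy; have [g hg] : exists g : deg -> S, forall a,
    monomial_comp a (g a) /\ y a = quot_pi I (g a).
  exists (fun a => s2val (cid2 (hy a))) => a.
  exact: (conj (s2valP (cid2 (hy a))) (s2valP' (cid2 (hy a)))).
under eq_bigr do rewrite (hg _).2.
rewrite -rmorph_sum => /eqP; rewrite quot_pi_eq0 => h a as_.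
apply/eqP; rewrite (hg a).2 quot_pi_eq0.
rewrite -(monomial_part_uniq us (fun a => (hg a).1) as_).
exact: monomial_part_in.
Qed.

Definition quotient_module : gradedModule K n :=
  GradedModule quot_comp0 quot_compD quot_compZ quot_compX
    quot_span quot_direct.

End GradedModules.

Section PrimaryDecomposition.
Variables (K : fieldType) (n : nat).
Local Notation S := {mpoly K[n]}.

Definition radical (Q : idealr S) (f : S) : Prop := exists m, f ^+ m \in Q.

(* Properness of Q is part of the type idealr. *)
Definition is_primary (Q : idealr S) : Prop :=
  forall f g : S, f * g \in Q -> f \in Q \/ radical Q g.

Definition irredundant_primary_decomposition k
    (I : monomialIdeal K n) (Q : 'I_k -> monomialIdeal K n) : Prop :=
  [/\ forall j, is_primary (Q j),
      forall f : S, (f \in (I : idealr S)) <-> (forall j, f \in (Q j : idealr S)),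
      forall i j, i != j -> ~ (forall f, radical (Q i) f <-> radical (Q j) f) &
      forall i, ~ (forall f : S,
        (f \in (I : idealr S)) <-> (forall j, j != i -> f \in (Q j : idealr S)))].

Definition ideal_vars (P : S -> Prop) : {set 'I_n} := [set i | `[< P 'X_i >]].

(* For an ideal generated by variables, ideal_vars is the set of these
   generators. *)
Lemma ideal_vars_generated (W : {set 'I_n}) (P : S -> Prop) :
  (forall f, P f <-> ideal_generated (fun g => exists2 i, i \in W & g = 'X_i) f) ->
  ideal_vars P = W.
Proof.
move=> hP; apply/setP => i; rewrite inE; apply/asboolP/idP => [/hP[s [hs hi]]|iW].
  apply: contraT => iW.
  have /eqP : ('X_i : S).@[fun j => (j \notin W)%:R] = 0.
    rewrite hi raddf_sum /= big_seq big1 // => u /hs[j jW ->].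
    by rewrite mevalM mevalXU jW mulr0.
  by rewrite mevalXU iW oner_eq0.
apply/hP; exists [:: (1, 'X_i)]; split; last by rewrite big_seq1 mul1r.
by move=> u; rewrite inE => /eqP -> /=; exists i.
Qed.

End PrimaryDecomposition.

(* Main.v *)
From HB Require Import structures.
Require Import Defs.
From mathcomp Require Import all_boot all_order all_algebra.
From mathcomp Require Import boolp zify.

Set Implicit Arguments.
Unset Strict Implicit.
Unset Printing Implicit Defensive.

Import Order.TTheory GRing.Theory Num.Theory.
Local Open Scope ring_scope.

(** Why the bounds hold.  In I and in S/I every graded component has dimension
    at most one, so a Stanley decomposition is the same thing as a partition of
    the set of monomials in I (resp. outside I) into finitely many blocks
    a + N^Z, and its Stanley depth is the least |Z|.  Everything else is
    combinatorics of such partitions.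

    Lower bounds.  Two blocks a + N^Z and b + N^Y are disjoint or meet in the
    block lcm(a, b) + N^(Z /\ Y), and |Z /\ Y| >= |Z| + |Y| - n.  Hence
    partitions of two sets refine to a partition of their intersection at a cost
    of n ([partitions_meet], [card_block_meet]); iterating over Q_1, ..., Q_k
    gives the lower bound for I.  For S/I, the complement of I is the disjoint
    union of the sets of monomials that lie in Q_1, ..., Q_(i-1) but not in Q_i,
    for i from 1 to k.  The complement of the
    primary ideal Q_i is partitioned by blocks of dimension n - d_i, since
    variables outside P_i can be cancelled in Q_i while those in P_i have a
    power in Q_i ([primary_complement_partition]); intersecting it with a
    partition of Q_1, ..., Q_(i-1) gives the i-th term of the minimum.

    Upper bounds.  By irredundancy there is a monomial b outside I such that
    b x_i is in I for every x_i in P_1 ([irredundant_corner]).  For S/I, the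
    block of b cannot extend in any direction of P_1, so n - d_1 bounds its
    dimension ([block_avoids]).  For I, the monomials b x_i lie in different
    blocks, and each pair {i, j} of variables of P_1 can be used by the block of
    b x_i or by that of b x_j but not by both, as b x_i x_j lies in one block
    only.  Counting pairs gives n - floor(d_1 / 2) ([corner_bound]).

    The Stanley depth 0 is also the value for a module without Stanley
    decomposition.  All bounds are trivial when the depths they start from
    vanish, and a positive depth is attained ([sdepth_partition]). *)

(** * Blocks of monomials *)

Section Blocks.
Variable n : nat.
Implicit Types (a b c : 'X_{1..n}) (u v : 'X_{1..n} * {set 'I_n}).

(** The pair (a, Z) stands for the monomials of 'X_[a] K[Z]. *)
Definition in_block u b :=
  (u.1 <= b)%MM && [forall i, (i \notin u.2) ==> (b i == u.1 i)].

Lemma in_blockP u b :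
  reflect (forall i, (u.1 i <= b i)%N /\ (i \notin u.2 -> b i = u.1 i))
    (in_block u b).
Proof.
apply: (iffP andP) => [[/mnm_lepP le_ub /forallP eq_ub] i|h].
  by split=> // iu; move/implyP: (eq_ub i) => /(_ iu) /eqP.
split; first by apply/mnm_lepP => i; have [] := h i.
by apply/forallP => i; apply/implyP => iu; rewrite (h i).2.
Qed.

Lemma in_block_corner u : in_block u u.1.
Proof. by apply/in_blockP => i; split. Qed.

Lemma in_block_shift u b i : in_block u b -> i \in u.2 -> in_block u (b + U_(i))%MM.
Proof.
move=> /in_blockP h iu; apply/in_blockP => l; have [le_ub eq_ub] := h l.
rewrite mnmDE mnm1E; split; first by rewrite (leq_trans le_ub) ?leq_addr.
by case: eqP => [<-|_] //; rewrite ?iu // addn0.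
Qed.

(** Counting the blocks that contain b expresses covering and disjointness by one
    equation, which is additive for concatenations and multiplicative for
    intersections. *)
Definition partitions (A : pred 'X_{1..n}) (s : seq ('X_{1..n} * {set 'I_n})) :=
  forall b, count (in_block^~ b) s = A b.

Lemma partitions_block A s u b : partitions A s -> u \in s -> in_block u b -> A b.
Proof.
move=> As us ub; have: (0 < count (in_block^~ b) s)%N.
  by rewrite -has_count; apply/hasP; exists u.
by rewrite As lt0b.
Qed.

Lemma partitions_cover A s b : partitions A s -> A b ->
  exists2 u, u \in s & in_block u b.
Proof. by move=> As Ab; apply/hasP; rewrite has_count As Ab. Qed.

Lemma partitions_uniq A s u v b : partitions A s -> u \in s -> v \in s ->
  in_block u b -> in_block v b -> u = v.
Proof.
move=> As us vs ub vb; have := As b.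
rewrite (seq.permP (perm_to_rem us)) /= ub.
have [-> //|neq_uv] := eqVneq v u => eqA.
have: (0 < count (in_block^~ b) (rem u s))%N.
  rewrite -has_count; apply/hasP; exists v => //.
  by move: vs; rewrite (perm_mem (perm_to_rem us)) inE (negPf neq_uv).
by move: eqA; case: (A b) => /=; lia.
Qed.

(** The intersection of two blocks, as a list of at most one block: they meet
    exactly when the least common multiple of their corners lies in both. *)
Definition block_meet u v : seq ('X_{1..n} * {set 'I_n}) :=
  let w := (mlcm u.1 v.1, u.2 :&: v.2) in
  if in_block u w.1 && in_block v w.1 then [:: w] else [::].

Lemma count_block_meet u v b :
  count (in_block^~ b) (block_meet u v) = in_block u b && in_block v b.
Proof.
rewrite /block_meet; set m := mlcm _ _.
have mE i : m i = maxn (u.1 i) (v.1 i) by rewrite mnmE.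
have [/andP[/in_blockP um /in_blockP vm]|nm] /= := boolP (_ && _).
  rewrite addn0; congr nat_of_bool; apply/in_blockP/andP => /= [h|[]].
    split; apply/in_blockP => i; have [le_mb eq_mb] := h i.
      have [le_um eq_um] := um i; split=> [|iu]; first exact: leq_trans le_mb.
      by rewrite eq_mb ?inE ?(negPf iu) // eq_um.
    have [le_vm eq_vm] := vm i; split=> [|iv]; first exact: leq_trans le_mb.
    by rewrite eq_mb ?inE ?(negPf iv) ?andbF // eq_vm.
  move=> /in_blockP ub /in_blockP vb i.
  have [le_ub eq_ub] := ub i; have [le_vb eq_vb] := vb i.
  split; first by rewrite mE geq_max le_ub.
  rewrite inE negb_and => /orP[iu|iv].
    by rewrite eq_ub // (um i).2.
  by rewrite eq_vb // (vm i).2.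
apply/esym/eqP; rewrite eqb0; apply: contra nm => /andP[/in_blockP ub /in_blockP vb].
apply/andP; split; apply/in_blockP => i /=; rewrite mE;
  have [le_ub eq_ub] := ub i; have [le_vb eq_vb] := vb i.
  by rewrite leq_maxl; split=> // iu; apply/maxn_idPl; rewrite -eq_ub.
by rewrite leq_maxr; split=> // iv; apply/maxn_idPr; rewrite -eq_vb.
Qed.

Lemma partitions_meet A B s t : partitions A s -> partitions B t ->
  partitions (fun b => A b && B b) (flatten [seq block_meet u v | u <- s, v <- t]).
Proof.
move=> As Bt b; rewrite -mulnb -As -Bt count_flatten.
elim: s {As} => [|u s ih]; first by rewrite /= mul0n.
rewrite /= map_cat sumn_cat ih mulnDl; congr addn; rewrite -map_comp.
elim: t {Bt ih} => [|v t ih] /=; first by rewrite muln0.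
by rewrite ih count_block_meet mulnDr mulnb.
Qed.

Lemma card_block_meet u v w : w \in block_meet u v ->
  (#|u.2| + #|v.2| <= #|w.2| + n)%N.
Proof.
rewrite /block_meet; case: ifP => // _; rewrite inE => /eqP -> /=.
rewrite -cardsUI addnC leq_add2l (leq_trans (max_card _)) //.
by rewrite card_ord.
Qed.

(** The integer form lets the bounds p and q be negative, as happens along the
    iteration over the primary components. *)
Lemma card_meet_blocks s t (p q : int) :
  (forall u, u \in s -> p <= #|u.2|%:Z) -> (forall v, v \in t -> q <= #|v.2|%:Z) ->
  forall w, w \in flatten [seq block_meet u v | u <- s, v <- t] ->
  p + q - n%:Z <= #|w.2|%:Z.
Proof.
move=> hs ht w /flattenP[r /allpairsP[[u v] /= [us vt ->]] /card_block_meet].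
by have := hs u us; have := ht v vt; move: #|u.2| #|v.2| #|w.2| => a b c; lia.
Qed.

(** If the block of b had a direction i in W, it would contain b + U_(i). *)
Lemma block_avoids A s b (W : {set 'I_n}) :
  partitions A s -> A b -> (forall i, i \in W -> ~~ A (b + U_(i))%MM) ->
  exists2 u, u \in s & (#|u.2| + #|W| <= n)%N.
Proof.
move=> As Ab out; have [u us ub] := partitions_cover As Ab; exists u => //.
have : u.2 \subset ~: W.
  apply/subsetP => i iu; rewrite inE; apply/negP => /out; apply/negP/negPn.
  exact: partitions_block As us (in_block_shift ub iu).
move/subset_leq_card; have := cardsC W; rewrite card_ord.
by move: #|W| #|~: W| #|u.2| => x y z; lia.
Qed.

(** The greatest common divisor of b x_i and b x_j is b, and a block is closed
    under greatest common divisors. *)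
Lemma in_block_gcd u b i j : i != j ->
  in_block u (b + U_(i))%MM -> in_block u (b + U_(j))%MM -> in_block u b.
Proof.
move=> neq_ij /in_blockP ui /in_blockP uj; apply/in_blockP => l.
have [le_i eq_i] := ui l; have [le_j eq_j] := uj l.
move: le_i eq_i le_j eq_j; rewrite !mnmDE !mnm1E.
case: (i =P l) => [eq_il|_]; last by rewrite addn0.
by rewrite -eq_il [j == i]eq_sym (negPf neq_ij) addn0.
Qed.

(** Double counting of the ordered pairs (i, j) in W such that j is a direction
    of the block of b + U_(i).  Reversing such a pair never gives another one, so
    there are at most |W| (|W| - 1) / 2 of them, while each i has at least
    d - 1 - (n - |W|) partners. *)
Lemma corner_bound A s b (W : {set 'I_n}) d :
  partitions A s -> ~~ A b -> (forall i, i \in W -> A (b + U_(i))%MM) ->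
  (forall u, u \in s -> (d <= #|u.2|)%N) -> (d <= n)%N -> (d + #|W| %/ 2 <= n)%N.
Proof.
move=> As nAb corner le_ds le_dn.
have /choice[g hg] : forall i, exists u, i \in W -> u \in s /\ in_block u (b + U_(i))%MM.
  move=> i; have [iW|_] := boolP (i \in W); last by exists (0%MM, set0).
  by have [u us ub] := partitions_cover As (corner i iW); exists u.
pose E i j : bool := [&& i \in W, j \in W, i != j & j \in (g i).2].
have asym i j : E i j -> ~~ E j i.
  case/and4P => iW jW neq_ij ji; apply/negP => /and4P[_ _ _ ij].
  have [gi_s gi_b] := hg i iW; have [gj_s gj_b] := hg j jW.
  (* Both blocks contain b + U_(i) + U_(j), hence they are equal, and then they
     contain b itself. *)
  have eq_g : g j = g i.
    apply: (partitions_uniq As gj_s gi_s (in_block_shift gj_b ij)).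
    by rewrite -addmA [(U_(j) + _)%MM]addmC addmA; apply: in_block_shift.
  move: nAb; apply/negP/negPn/(partitions_block As gi_s).
  by apply: in_block_gcd neq_ij gi_b _; rewrite -eq_g.
have out_deg i : i \in W -> (d + #|W| <= \sum_j E i j + n.+1)%N.
  move=> iW; have [gi_s _] := hg i iW; have := le_ds _ gi_s.
  have -> : (\sum_j E i j = #|((g i).2 :&: W) :\ i|)%N.
    rewrite -sum1_card [RHS]big_mkcond; apply: eq_bigr => j _; rewrite /E !inE iW.
    by rewrite [j == i]eq_sym; case: (j \in W); case: (i == j); case: (j \in _).
  have := cardsUI (g i).2 W; have := subset_leq_card (subsetT ((g i).2 :|: W)).
  rewrite cardsT card_ord (cardsD1 i ((g i).2 :&: W)).
  move: #|(g i).2 :|: W| #|_ :\ i| #|W| #|(g i).2| (i \in _) => x y z t [] /=; lia.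
have total : (\sum_(i in W) \sum_j E i j + \sum_(i in W) \sum_j E i j
    <= #|W| * #|W|.-1)%N.
  have drop (F : 'I_n -> 'I_n -> bool) : (forall i j, F i j -> i \in W) ->
      (\sum_(i in W) \sum_j F i j = \sum_i \sum_j F i j)%N.
    move=> FW; rewrite big_mkcond; apply: eq_bigr => i _; case: ifPn => // iW.
    by rewrite big1 // => j _; apply/eqP; rewrite eqb0; apply: contra iW; apply: FW.
  rewrite !drop; last by move=> i j /andP[].
  rewrite {2}exchange_big -big_split -sum_nat_const [leqRHS]big_mkcond.
  apply: leq_sum => i _; rewrite -big_split /=; case: ifPn => iW.
    rewrite (cardsD1 i) iW /= -sum1_card [leqRHS]big_mkcond; apply: leq_sum => j _.
    have := asym i j; rewrite !inE /E iW [j == i]eq_sym /=.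
    by case: (j \in W); case: (i == j); case: (j \in _); case: (i \in _) => // /(_ isT).
  by rewrite big1 // => j _; rewrite /E (negPf iW) andbF.
have sum_deg : (\sum_(i in W) (d + #|W|) <=
    \sum_(i in W) (\sum_j E i j + n.+1))%N by exact: leq_sum.
move: sum_deg; rewrite sum_nat_const big_split /= sum_nat_const => sum_deg.
move: total sum_deg; move: (\sum_(i in W) _)%N #|W| => e [|w] total sum_deg.
  by rewrite div0n addn0.
have : (w.+1 * (2 * (d + w.+1)) <= w.+1 * (w + 2 * n.+1))%N.
  by rewrite /= in total; nia.
by rewrite leq_pmul2l //; lia.
Qed.

End Blocks.

(** * Stanley decompositions as partitions into blocks *)

Section Bridge.
Variables (K : fieldType) (n : nat).
Local Notation S := {mpoly K[n]}.
Implicit Types (a b c : 'X_{1..n}) (p f : S) (Z : {set 'I_n}).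

Lemma mpolyX_eq0 a : ('X_[a] == 0 :> S) = false.
Proof. by rewrite -msupp_eq0 msuppX. Qed.

Lemma in_subringP Z p :
  reflect (forall b i, b \in msupp p -> i \notin Z -> b i = 0%N) (in_subring Z p).
Proof.
apply: (iffP allP) => [h b i bp iZ|h b bp].
  by move/forallP: (h b bp) => /(_ i); rewrite iZ => /eqP.
by apply/forallP => i; apply/implyP => iZ; rewrite (h b i).
Qed.

Lemma msupp_mulX_block a Z p b :
  in_subring Z p -> b \in msupp (p * 'X_[a]) -> in_block (a, Z) b.
Proof.
move=> /in_subringP pZ; rewrite (perm_mem (msuppMX _ _)) => /mapP[c cp ->].
apply/in_blockP => i /=; rewrite mnmDE leq_addr; split=> // iZ.
by rewrite (pZ c) // addn0.
Qed.

Lemma block_mulX a Z f : (forall b, b \in msupp f -> in_block (a, Z) b) ->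
  exists2 p, in_subring Z p & p * 'X_[a] = f.
Proof.
move=> fZ; exists (\sum_(b <- msupp f) f@_b *: 'X_[b - a]).
  apply/in_subringP => c i /msupp_sum_le /flatten_mapP[b].
  rewrite filter_predT => bf /msuppZ_le; rewrite msuppX inE => /eqP -> iZ.
  have /in_blockP /(_ i) /= [_ eq_ab] := fZ b bf.
  by rewrite mnmBE eq_ab // subnn.
rewrite mulr_suml [RHS]mpolyE; apply: eq_big_seq => b bf.
rewrite -scalerAl -mpolyXD submK //.
by have /andP[] := fZ b bf.
Qed.

Definition restriction (B : pred 'X_{1..n}) f : S :=
  \sum_(b <- msupp f | B b) f@_b *: 'X_[b].

Lemma mcoeff_restriction B f b :
  (restriction B f)@_b = if B b then f@_b else 0.
Proof.
rewrite /restriction raddf_sum /=.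
under eq_bigr do rewrite mcoeffZ mcoeffX.
have [bf|nbf] := boolP (b \in msupp f); last first.
  rewrite memN_msupp_eq0 // if_same big_seq_cond big1 // => c /andP[cf _].
  by case: (c =P b) => [cb|_]; rewrite ?mulr0 //; rewrite -cb cf in nbf.
rewrite big_mkcond (bigD1_seq b) ?msupp_uniq //= eqxx mulr1 big1 ?addr0 //.
by move=> c /negPf ->; rewrite mulr0 if_same.
Qed.

Lemma msupp_restriction B f b :
  b \in msupp (restriction B f) -> B b && (b \in msupp f).
Proof. by rewrite !mcoeff_msupp mcoeff_restriction; case: (B b); rewrite ?eqxx. Qed.

(** The graded components of the polynomial ring are lines. *)
Lemma monomial_comp_term (g : {ffun 'I_n -> int}) f : monomial_comp g f -> f != 0 ->
  exists a, f = f@_a *: 'X_[a] /\ f@_a != 0.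
Proof.
move=> hf; rewrite -msupp_eq0; case E: (msupp f) => [//|a s] _.
have af : a \in msupp f by rewrite E mem_head.
exists a; split; last by rewrite -mcoeff_msupp.
apply/mpolyP => b; rewrite mcoeffZ mcoeffX; case: eqP => [->|/eqP ab].
  by rewrite mulr1.
rewrite mulr0; apply: memN_msupp_eq0; apply: contra ab => bf.
by apply/eqP/(@zdeg_inj n); rewrite (hf a) // (hf b).
Qed.

(** An embedding of M into the polynomials as the span of the monomials in A, on
    which multiplication is that of polynomials followed by the projection that
    discards the monomials outside A.  It treats I (where nothing is discarded)
    and S/I (where A is the complement of I) at the same time. *)
Record coordinates (M : gradedModule K n) (A : pred 'X_{1..n}) := Coordinates {
  coord :> {additive gm_sort M -> S};
  coord_eq0 : forall x, coord x = 0 -> x = 0;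
  coord_supp : forall x b, b \in msupp (coord x) -> A b;
  coord_surj : forall f, (forall b, b \in msupp f -> A b) -> exists x, coord x = f;
  coord_scale : forall p x b, A b -> (coord (p *: x))@_b = (p * coord x)@_b;
  coord_homogeneous : forall x : M,
    homogeneous x <-> exists g, monomial_comp g (coord x)
}.

Section Coordinates.
Variables (M : gradedModule K n) (A : pred 'X_{1..n}) (nf : coordinates M A).
Implicit Types (m x y : M).

Lemma coord_inj : injective nf.
Proof.
move=> x y eq_xy; apply/eqP; rewrite -subr_eq0; apply/eqP/(@coord_eq0 _ _ nf).
by rewrite raddfB eq_xy subrr.
Qed.

Lemma coord_out x b : ~~ A b -> (nf x)@_b = 0.
Proof. by move=> nAb; apply: memN_msupp_eq0; apply: contra nAb; exact: coord_supp. Qed.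

(** Multiplication is polynomial as long as no monomial leaves A. *)
Lemma coord_scale_sub p x :
  (forall b, b \in msupp (p * nf x) -> A b) -> nf (p *: x) = p * nf x.
Proof.
move=> h; apply/mpolyP => b; have [Ab|nAb] := boolP (A b); first exact: coord_scale.
by rewrite coord_out // memN_msupp_eq0 //; apply: contra nAb; apply: h.
Qed.

Lemma coord_homogeneous_term m : homogeneous m -> m != 0 ->
  exists (c : K) a, [/\ nf m = c *: 'X_[a], c != 0 & A a].
Proof.
move=> /(coord_homogeneous nf)[g mg] m0.
have [|a [eq_m ma0]] := monomial_comp_term mg.
  by apply: contra m0 => /eqP h; apply/eqP/(@coord_eq0 _ _ nf).
by exists (nf m)@_a, a; split=> //; apply: (@coord_supp _ _ nf m); rewrite mcoeff_msupp.
Qed.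

Lemma stanley_spaceP m Z (c : K) a : nf m = c *: 'X_[a] -> c != 0 ->
  (forall b, in_block (a, Z) b -> A b) ->
  forall x, stanley_space m Z x <-> (forall b, b \in msupp (nf x) -> in_block (a, Z) b).
Proof.
move=> eq_m c0 blkA x; split=> [[p pZ ->] b|/block_mulX[p pZ eq_p]].
  rewrite mcoeff_msupp => nz; have Ab : A b.
    by apply: contraNT nz => nAb; rewrite coord_out.
  move: nz; rewrite coord_scale // eq_m -scalerAr -mcoeff_msupp => /msuppZ_le.
  exact: msupp_mulX_block.
exists (c^-1 *: p).
  by apply/in_subringP => b i /msuppZ_le; move: b i; apply/in_subringP.
have eq_x : (c^-1 *: p) * nf m = nf x.
  by rewrite eq_m -scalerAl -scalerAr eq_p scalerA mulVf // scale1r.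
apply: coord_inj; rewrite coord_scale_sub eq_x // => b; exact: coord_supp.
Qed.

(** Freeness of m K[Z] says that no monomial of the block is discarded by the
    projection onto A. *)
Lemma stanley_free_block m Z (c : K) a : nf m = c *: 'X_[a] -> c != 0 ->
  stanley_free m Z <-> (forall b, in_block (a, Z) b -> A b).
Proof.
move=> eq_m c0; split=> [free b ab|blkA p pZ pm0].
  have [|p pZ eq_p] := @block_mulX a Z 'X_[b].
    by move=> d; rewrite msuppX inE => /eqP ->.
  apply/negPn/negP => nAb; suff p0 : p = 0.
    by move/eqP: eq_p; rewrite p0 mul0r eq_sym mpolyX_eq0.
  apply: free => //; apply: coord_inj; rewrite raddf0; apply/mpolyP => d.
  rewrite mcoeff0; have [Ad|nAd] := boolP (A d); last by rewrite coord_out.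
  rewrite coord_scale // eq_m -scalerAr eq_p mcoeffZ mcoeffX.
  case: eqP => [eq_bd|_]; last by rewrite mulr0.
  by rewrite eq_bd Ad in nAb.
have /eqP := congr1 nf pm0; rewrite coord_scale_sub => [|b]; last first.
  by rewrite eq_m -scalerAr => /msuppZ_le /(msupp_mulX_block pZ) /blkA.
rewrite raddf0 mulf_eq0 eq_m scaler_eq0 (negPf c0) mpolyX_eq0 !orbF.
by move/eqP.
Qed.

Lemma partition_of_stanley t (m : 'I_t -> M) (Z : 'I_t -> {set 'I_n}) :
  stanley_decomposition m Z ->
  exists a : 'I_t -> 'X_{1..n},
    partitions A [seq (a i, Z i) | i <- enum 'I_t].
Proof.
move=> [hom free dec].
have m0 i : m i != 0.
  apply/eqP => mi0; suff /eqP : (1 : S) = 0 by rewrite oner_eq0.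
  apply: (free i); last by rewrite mi0 scaler0.
  apply/in_subringP => b l; rewrite msupp1 inE => /eqP -> _.
  by rewrite mnm0E.
have /choice[ca hca] : forall i, exists u : K * 'X_{1..n},
    [/\ nf (m i) = u.1 *: 'X_[u.2], u.1 != 0 & A u.2].
  by move=> i; have [c [a h]] := coord_homogeneous_term (hom i) (m0 i); exists (c, a).
have blkA i b : in_block ((ca i).2, Z i) b -> A b.
  by have [eq_m c0 _] := hca i; move: b; apply/(stanley_free_block _ eq_m).
have spaceP i x : stanley_space (m i) (Z i) x <->
    (forall b, b \in msupp (nf x) -> in_block ((ca i).2, Z i) b).
  by have [eq_m c0 _] := hca i; apply: stanley_spaceP eq_m c0 _ x; exact: blkA.
exists (fun i => (ca i).2) => b.
rewrite count_map -sum1_count big_enum_cond /=.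
have [Ab|nAb] := boolP (A b); last first.
  by rewrite big_pred0 // => i; apply: contraNF nAb; exact: blkA.
have [x nfx] : exists x, nf x = 'X_[b].
  by apply: (coord_surj nf) => c; rewrite msuppX inE => /eqP ->.
have x0 : x != 0.
  by apply: contraTneq isT => x0; move/eqP: nfx; rewrite x0 raddf0 eq_sym mpolyX_eq0.
have [y [[ys eq_x] y_uniq]] := dec x.
have [i ib] : exists i, in_block ((ca i).2, Z i) b.
  apply/existsP; apply: contraTT isT => /existsPn nob.
  have /eqP := congr1 (mcoeff b) nfx; rewrite mcoeffX eqxx eq_x !raddf_sum /=.
  rewrite big1 ?(eq_sym 0) ?oner_eq0 // => i _; apply: memN_msupp_eq0.
  by apply: contra (nob i); apply: (proj1 (spaceP i _) (ys i)).
(* The monomial 'X_[b] lies in the summand of each block containing b, and a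
   direct sum leaves room for only one such summand. *)
have y_delta j : in_block ((ca j).2, Z j) b -> y = [ffun l => if l == j then x else 0].
  move=> jb; apply: y_uniq; split=> [l|].
    rewrite ffunE; apply/spaceP => c; case: eqP => [->|_]; last by rewrite raddf0 msupp0.
    by rewrite nfx msuppX inE => /eqP ->.
  by under eq_bigr do rewrite ffunE; rewrite -big_mkcond big_pred1_eq.
rewrite (eq_bigl (pred1 i)) ?big_pred1_eq // => j /=.
apply/idP/eqP => [jb|-> //]; apply/eqP; apply: contraNT x0 => neq_ji.
have := y_delta j jb; rewrite (y_delta i ib) => /ffunP/(_ i).
by rewrite !ffunE eqxx eq_sym (negPf neq_ji) => ->.
Qed.

(** The component of x in the summand of a block is the restriction of its
    coordinates to that block. *)
Lemma stanley_of_partition s : partitions A s ->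
  exists m : 'I_(size s) -> M,
    stanley_decomposition m (fun i => (tnth (in_tuple s) i).2).
Proof.
move=> As; pose u i := tnth (in_tuple s) i.
have blkA i b : in_block ((u i).1, (u i).2) b -> A b.
  rewrite -surjective_pairing; apply: (partitions_block As).
  exact: (mem_tnth i (in_tuple s)).
have count_u b : (\sum_(i < size s) in_block (u i) b = A b)%N.
  by rewrite -As -sum1_count big_tnth [RHS]big_mkcond; apply: eq_bigr => i _; case: ifP.
have /choice[m nfm] : forall i, exists x, nf x = 'X_[(u i).1].
  move=> i; apply: (coord_surj nf) => c; rewrite msuppX inE => /eqP ->.
  exact/(blkA i)/in_block_corner.
have nfm1 i : nf (m i) = 1 *: 'X_[(u i).1] by rewrite scale1r.
have spaceP i := stanley_spaceP (nfm1 i) (oner_neq0 K) (blkA i).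
exists m; split=> [i|i|x].
- apply/(coord_homogeneous nf); exists (zdeg (u i).1) => b.
  by rewrite nfm msuppX inE => /eqP ->.
- by apply/(stanley_free_block _ (nfm1 i)); rewrite ?oner_neq0 //; exact: blkA.
have /choice[y nfy] : forall i, exists y, nf y = restriction (in_block (u i)) (nf x).
  move=> i; apply: (coord_surj nf) => b /msupp_restriction /andP[_].
  exact: coord_supp.
have at_most_one i j b : in_block (u i) b -> in_block (u j) b -> i = j.
  move=> ib jb; apply/eqP/negPn/negP => neq_ij; have := count_u b.
  by rewrite (bigD1 i) //= (bigD1 j) 1?eq_sym //= ib jb; case: (A b).
exists [ffun i => y i]; split=> [|z [zs eq_x]].
  split=> [i|].
    rewrite ffunE; apply/spaceP => b; rewrite nfy -surjective_pairing.
    by case/msupp_restriction/andP.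
  apply: coord_inj; apply/mpolyP => b; rewrite !raddf_sum /=.
  under eq_bigr do rewrite ffunE nfy mcoeff_restriction -mulrb.
  rewrite sumrMnr count_u.
  by case: (boolP (A b)) => [//|/coord_out ->].
apply/ffunP => i; rewrite ffunE; apply: coord_inj; apply/mpolyP => b.
rewrite nfy mcoeff_restriction; case: ifPn => ib; last first.
  apply/esym/memN_msupp_eq0; apply: contra ib => /(proj1 (spaceP i (z i)) (zs i)).
  by rewrite -surjective_pairing.
rewrite eq_x !raddf_sum /= (bigD1 i) //= big1 ?addr0 // => j neq_ji.
apply: memN_msupp_eq0; apply: contra neq_ji => /(proj1 (spaceP j (z j)) (zs j)).
by rewrite -surjective_pairing => jb; apply/eqP/(at_most_one _ _ _ jb ib).
Qed.

(** As A is nonempty there is a block, so that e <= n, the default value of the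
    minimum in [sdepth_of]. *)
Lemma le_sdepth_partition s b (e : int) : partitions A s -> A b ->
  (forall u, u \in s -> e <= #|u.2|%:Z) -> e <= (sdepth M)%:Z.
Proof.
case: e => // e As Ab le_es; have [m dec] := stanley_of_partition As.
have le_en : (e <= n)%N.
  have [u us _] := partitions_cover As Ab; have := le_es u us; rewrite lez_nat.
  by move/leq_trans; apply; rewrite -[leqRHS]card_ord max_card.
rewrite lez_nat; apply: leq_trans (sdepth_ge dec); rewrite /sdepth_of.
elim/big_rec: _ => // i d _ le_ed; rewrite leq_min le_ed andbT.
exact: (le_es _ (mem_tnth i (in_tuple s))).
Qed.

Lemma sdepth_le : (sdepth M <= n)%N.
Proof. by apply/bigmax_leqP => d _; rewrite -ltnS. Qed.

(** Positivity excludes the value 0 of the maximum over no decomposition. *)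
Lemma sdepth_partition : (0 < sdepth M)%N ->
  exists2 s, partitions A s & forall u, u \in s -> (sdepth M <= #|u.2|)%N.
Proof.
rewrite /sdepth; set P := (X in \max_(d < _ | X d) _) => sd0.
have [d Pd] : exists d, P d.
  apply/existsP; apply: contraTT sd0 => /existsPn noP.
  by rewrite big_pred0 // => d; apply/negbTE.
have P0 : (0 < #|P|)%N by apply/card_gt0P; exists d.
have [e] := eq_bigmax_cond (fun d : 'I_n.+1 => d : nat) P0.
rewrite unfold_in => /asboolP[t [m [Z [dec eq_e]]]] ->.
have [a As] := partition_of_stanley dec.
exists [seq (a i, Z i) | i <- enum 'I_t] => // u /mapP[i _ ->] /=.
rewrite -eq_e /sdepth_of; have := mem_index_enum i.
elim: (index_enum _) => // j r ih; rewrite inE big_cons geq_min.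
by case/orP => [/eqP -> | /ih ->]; rewrite ?leqnn ?orbT.
Qed.

End Coordinates.

(** * Monomial ideals and their primary components *)

Section Ideals.
Variable I : monomialIdeal K n.
Local Notation mon b := ('X_[b] \in (I : idealr S)).

Lemma mem_msupp f : (forall b, b \in msupp f -> mon b) -> f \in (I : idealr S).
Proof.
move=> h; rewrite [f]mpolyE big_seq rpred_sum // => b /h bI.
by rewrite -mul_mpolyC idealMr.
Qed.

Lemma mem_mon_add a b : mon a -> mon (a + b)%MM.
Proof. by move=> aI; rewrite mpolyXD mulrC idealMr. Qed.

Lemma mem_mon_le a b : (a <= b)%MM -> mon a -> mon b.
Proof. by move=> /submK <- aI; rewrite addmC mem_mon_add. Qed.

Lemma ideal_coordinates : inhabited (coordinates (ideal_module I) (fun b => mon b)).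
Proof.
have valB : zmod_morphism (fun x : ideal_sub I => val x) by [].
pose add := GRing.isZmodMorphism.Build (ideal_sub I) S _ valB.
pose nf : {additive ideal_sub I -> S} := HB.pack (fun x : ideal_sub I => val x) add.
constructor; unshelve eapply (@Coordinates (ideal_module I) _ nf _ _ _ _ _) => //.
- by move=> x x0; apply/val_inj.
- by move=> x b; apply: monomial_ideal_msupp (valP x).
- by move=> f /mem_msupp fI; exists (exist _ f fI).
Qed.

Lemma quotient_coordinates :
  inhabited (coordinates (quotient_module I) (fun b => ~~ mon b)).
Proof.
(* The normal form of a class is the part outside I of any representative. *)
pose tr f := restriction (fun b => ~~ mon b) f.
have trB : {morph tr : f g / f - g}.
  move=> f g; apply/mpolyP => b; rewrite mcoeffB !mcoeff_restriction mcoeffB.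
  by case: ifP; rewrite ?subr0.
have tr_ideal f : f \in (I : idealr S) -> tr f = 0.
  move=> fI; apply/mpolyP => b; rewrite mcoeff_restriction mcoeff0.
  case: ifPn => // nb; apply: memN_msupp_eq0; apply: contra nb.
  exact: monomial_ideal_msupp.
have sub_tr f : f - tr f \in (I : idealr S).
  apply: mem_msupp => b; rewrite mcoeff_msupp mcoeffB mcoeff_restriction.
  by case: (boolP (mon b)) => //= _; rewrite subrr eqxx.
have pi_eq f g : quot_pi I f = quot_pi I g -> tr f = tr g.
  move=> /eqP; rewrite -subr_eq0 -rmorphB quot_pi_eq0 => /tr_ideal /eqP.
  by rewrite trB subr_eq0 => /eqP.
have pi_tr f : quot_pi I (tr f) = quot_pi I f.
  by apply/eqP; rewrite eq_sym -subr_eq0 -rmorphB quot_pi_eq0.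
have /choice[r pi_r] := @quot_pi_surj _ I.
pose g x := tr (r x).
have g_pi f : g (quot_pi I f) = tr f by apply: pi_eq.
have pi_g x : quot_pi I (g x) = x by rewrite pi_tr.
have gB : zmod_morphism g.
  move=> x y; have tr_g z : tr (g z) = g z by rewrite -(g_pi (g z)) pi_g.
  have -> : x - y = quot_pi I (g x - g y) by rewrite rmorphB /= !pi_g.
  by rewrite g_pi trB !tr_g.
pose add := GRing.isZmodMorphism.Build (quot_sub I) S _ gB.
pose nf : {additive quot_sub I -> S} := HB.pack g add.
constructor; unshelve eapply (@Coordinates (quotient_module I) _ nf _ _ _ _ _) => //=.
- by move=> x x0; rewrite -[x]pi_g x0 rmorph0.
- by move=> x b /msupp_restriction /andP[].
- move=> f fN; exists (quot_pi I f); rewrite g_pi; apply/mpolyP => b.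
  rewrite mcoeff_restriction; case: ifPn => // nb; apply/esym/memN_msupp_eq0.
  by apply: contra nb; apply: fN.
- move=> p x b nb; have -> : p *: x = quot_pi I (p * g x).
    by rewrite rmorphM /= pi_g.
  by rewrite g_pi mcoeff_restriction nb.
move=> x; split=> [[e [f fe ->]]|[e ge]].
  by exists e => b; rewrite g_pi => /msupp_restriction /andP[_]; apply: fe.
by exists e, (g x).
Qed.


(** Starting from a, multiply by variables of W as long as the result stays
    outside the ideal; the powers in the ideal make this stop. *)
Lemma corner_exists (W : {set 'I_n}) N a :
  (forall i, i \in W -> mon (U_(i) *+ N)%MM) -> ~~ mon a ->
  exists b, [/\ (a <= b)%MM, ~~ mon b & forall i, i \in W -> mon (b + U_(i))%MM].
Proof.
move=> powers; have [t] := ubnP (\sum_(i in W) (N - a i))%N.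
elim: t a => // t ih a; rewrite ltnS => le_t na.
have [/forallP all_in|] := boolP [forall i, (i \in W) ==> mon (a + U_(i))%MM].
  by exists a; split=> [||i iW]; [exact: lepm_refl | | exact: (implyP (all_in i))].
rewrite negb_forall => /existsP[i]; rewrite negb_imply => /andP[iW nai].
have [|//|b [le_ab nb corner]] := ih (a + U_(i))%MM.
  apply: leq_trans le_t; rewrite [in X in (X <= _)%N](bigD1 i) // [leqRHS](bigD1 i) //=.
  rewrite mnmDE mnm1E eqxx addn1 -addSn leq_add //.
    have lt_aN : (a i < N)%N.
      rewrite ltnNge; apply: contra na => le_Na; apply: mem_mon_le (powers i iW).
      apply/mnm_lepP => l; rewrite mulmnE mnm1E.
      by case: eqP => [<-|]; rewrite ?mul1n ?mul0n.
    by lia.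
  apply: leq_sum => j /andP[_ /negPf neq_ji].
  by rewrite mnmDE mnm1E eq_sym neq_ji addn0.
by exists b; split=> //; apply: lepm_trans le_ab; exact: lem_addr.
Qed.

Lemma radical_powers : exists N,
  forall i, i \in ideal_vars (radical I) -> mon (U_(i) *+ N)%MM.
Proof.
have /choice[e he] : forall i, exists e,
    i \in ideal_vars (radical I) -> mon (U_(i) *+ e)%MM.
  move=> i; have [|_] := boolP (i \in _); last by exists 0%N.
  by rewrite inE => /asboolP[e he]; exists e => _; rewrite -mpolyXn.
exists (\max_i e i) => i /he; apply: mem_mon_le.
by apply/mnm_lepP => l; rewrite !mulmnE leq_mul2l leq_bigmax orbT.
Qed.

(** In a primary ideal, variables outside the radical can be cancelled one at a
    time. *)
Lemma primary_cancel (a b : 'X_{1..n}) : is_primary I ->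
  (forall i, i \in ideal_vars (radical I) -> b i = 0%N) -> mon (a + b)%MM -> mon a.
Proof.
move=> prim; have [t] := ubnP (mdeg b); elim: t b => // t ih b; rewrite ltnS => le_t b0.
have [->|] := eqVneq b 0%MM; first by rewrite addm0.
rewrite -mdeg_eq0 mdegE sum_nat_eq0 negb_forall => /existsP[i bi0].
have iW : i \notin ideal_vars (radical I) by apply: contraNN bi0 => /b0 ->.
have eq_b : (b - U_(i) + U_(i))%MM = b by rewrite submK ?lep1mP.
rewrite -eq_b addmA mpolyXD => /prim[|rad]; last first.
  by move: iW; rewrite inE; move/asboolP; case.
apply: ih => [|j /b0]; last by rewrite mnmBE => ->.
by move: le_t; rewrite -[in mdeg b]eq_b mdegD mdeg1 addn1.
Qed.

(** Membership in a primary ideal depends only on the exponents in W, the set of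
    variables of its radical, and outside the ideal these are bounded; so the
    complement is a finite union of fibres of the projection onto N^W, which are
    blocks in the directions outside W. *)
Lemma primary_complement_partition : is_primary I ->
  exists2 s, partitions (fun b => ~~ mon b) s &
    forall u, u \in s -> u.2 = ~: ideal_vars (radical I).
Proof.
move=> prim; set W := ideal_vars (radical I).
have [N powers] := radical_powers.
pose cut b : 'X_{1..n} := [multinom if i \in W then b i else 0%N | i < n].
have cut_le b : (cut b <= b)%MM.
  by apply/mnm_lepP => i; rewrite mnmE; case: ifP.
have mon_cut b : mon (cut b) = mon b.
  apply/idP/idP; first exact: mem_mon_le.
  rewrite -[b in X in X -> _](submK (cut_le b)) addmC; apply: primary_cancel => // i iW.
  by rewrite mnmBE mnmE -/W iW subnn.
have cut_bound b : ~~ mon b -> (mdeg (cut b) < (n * N).+1)%N.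
  move=> nb; have -> : (n * N = \sum_(i < n) N)%N by rewrite sum_nat_const card_ord.
  rewrite ltnS mdegE leq_sum // => i _.
  rewrite mnmE; case: ifP => // iW; rewrite leqNgt; apply: contra nb => lt_Nb.
  apply: mem_mon_le (powers i iW); apply/mnm_lepP => l; rewrite mulmnE mnm1E.
  by case: eqP => [<-|]; rewrite ?mul1n ?mul0n // ltnW.
pose corner (w : 'X_{1..n < (n * N).+1}) := (cut w == w) && ~~ mon w.
exists [seq (bmnm w, ~: W) | w <- enum corner] => [b|u /mapP[w _ ->] //].
have blockE (w : 'X_{1..n < (n * N).+1}) :
    corner w && in_block (bmnm w, ~: W) b = (bmnm w == cut b) && ~~ mon b.
  apply/andP/andP => [[/andP[/eqP cut_w nw] /in_blockP wb]|[/eqP eq_w nb]].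
    have eq_w : bmnm w = cut b.
      apply/mnmP => i; rewrite -cut_w !mnmE; case: ifP => // iW.
      by have [_ ->] := wb i; rewrite // inE iW.
    by rewrite eq_w eqxx -mon_cut -eq_w.
  rewrite /corner eq_w mon_cut nb andbT; split.
    by apply/eqP/mnmP => i; rewrite !mnmE; case: (i \in W).
  apply/in_blockP => i /=; rewrite mnmE; by case: ifP => iW; rewrite inE iW ?leqnn.
rewrite count_map -sum1_count big_enum_cond /=.
under eq_bigl => w do rewrite blockE.
have [_|nb] := boolP (mon b); first by rewrite big_pred0 // => w; rewrite andbF.
rewrite (eq_bigl (pred1 (BMultinom (cut_bound b nb)))) ?big_pred1_eq // => w.
by rewrite andbT.
Qed.

End Ideals.

(** Irredundancy gives a monomial in all components but Q j; pushing it as far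
    as possible outside Q j along the variables of the radical of Q j keeps it in
    the other components. *)
Lemma irredundant_corner k (I : monomialIdeal K n) (Q : 'I_k -> monomialIdeal K n) j :
  irredundant_primary_decomposition I Q ->
  exists b, 'X_[b] \notin (I : idealr S) /\
    forall i, i \in ideal_vars (radical (Q j)) -> 'X_[b + U_(i)] \in (I : idealr S).
Proof.
move=> [_ decI _ irr].
have [f fQ fI] : exists2 f : S, forall l, l != j -> f \in (Q l : idealr S) &
    f \notin (I : idealr S).
  apply: contrapT => none; apply: (irr j) => f; split=> [/decI fI l _ //|fQ].
  by apply/negPn/negP => fI; apply: none; exists f.
have [a aQ aj] : exists2 a, a \in msupp f & 'X_[a] \notin (Q j : idealr S).
  apply/hasP; apply: contraR fI => /hasPn all_in; apply/decI => l.
  by have [->|/fQ //] := eqVneq l j; apply: mem_msupp => b /all_in /negPn.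
have [N powers] := radical_powers (Q j).
have [b [le_ab bj corner]] := corner_exists powers aj.
have bQ l : l != j -> 'X_[b] \in (Q l : idealr S).
  by move=> /fQ fl; apply: mem_mon_le le_ab (monomial_ideal_msupp fl aQ).
exists b; split; first by apply: contra bj => /decI.
move=> i iW; apply/decI => l; have [->|/bQ bl] := eqVneq l j.
  exact: corner.
exact: mem_mon_add.
Qed.

(** * Intersections of the first primary components *)

Section Intersections.
Variables (k : nat) (Q : 'I_k -> monomialIdeal K n).
Local Notation q j := (sdepth (ideal_module (Q j))).

Definition initial_mon i (b : 'X_{1..n}) : bool :=
  [forall j : 'I_k, (j < i)%N ==> ('X_[b] \in (Q j : idealr S))].

Lemma initial_mon_rec (i : 'I_k) b :
  initial_mon i.+1 b = initial_mon i b && ('X_[b] \in (Q i : idealr S)).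
Proof.
apply/forallP/andP => [all_in|[/forallP all_in in_i] j].
  split; last by apply: (implyP (all_in i)).
  apply/forallP => j; apply/implyP => lt_ji.
  by apply: (implyP (all_in j)); rewrite ltnS ltnW.
apply/implyP; rewrite ltnS leq_eqVlt => /orP[/eqP/val_inj -> //|].
exact: (implyP (all_in j)).
Qed.

Lemma initial_mon0 b : initial_mon 0 b.
Proof. by apply/forallP. Qed.

Lemma sum_initial (F : 'I_k -> int) (i : 'I_k) :
  \sum_(j < k | (j < i.+1)%N) F j = \sum_(j < k | (j < i)%N) F j + F i.
Proof.
rewrite (bigD1 i) //= addrC; congr (_ + _); apply: eq_bigl => j.
by rewrite ltnS ltn_neqAle andbC.
Qed.

(** A vanishing depth makes the bounds built from it nonpositive, hence trivial:
    of the i summands, all at most n, one is lost. *)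
Lemma sum_initial_zero (F : 'I_k -> nat) (j : 'I_k) i : (i <= k)%N -> (j < i)%N ->
  (forall l, (F l <= n)%N) -> F j = 0%N ->
  \sum_(l < k | (l < i)%N) (F l)%:Z <= n%:Z * (i%:Z - 1).
Proof.
move=> le_ik lt_ji le_Fn Fj0.
suff: \sum_(l < k | (l < i)%N) (F l)%:Z <= n%:Z * (i%:Z - (j < i)%N%:Z) by rewrite lt_ji.
elim: i le_ik {lt_ji} => [|i ih] le_ik; first by rewrite big_pred0 // ltn0 subr0 mulr0.
rewrite (sum_initial (fun l => (F l)%:Z) (Ordinal le_ik)) /=.
have := ih (ltnW le_ik); have := le_Fn (Ordinal le_ik).
have [eq_ji|neq_ji] := eqVneq j (Ordinal le_ik).
  rewrite -eq_ji Fj0 eq_ji /= ltnn ltnSn; nia.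
have -> : (j < i.+1)%N = (j < i)%N.
  by rewrite ltnS leq_eqVlt -[(j : nat) == i]/(j == Ordinal le_ik) (negPf neq_ji).
move: (\sum_(l < k | _) _) (F _) => x y; nia.
Qed.

(** The whole set of monomials is the single block 0 + N^n, of dimension
    n = 0 - n (0 - 1), so that the bound already holds for i = 0; each further
    ideal adds its Stanley depth and costs n. *)
Lemma initial_partition i : (i <= k)%N -> (forall j : 'I_k, (j < i)%N -> (0 < q j)%N) ->
  exists2 s, partitions (initial_mon i) s &
    forall u, u \in s ->
      \sum_(j < k | (j < i)%N) (q j)%:Z - n%:Z * (i%:Z - 1) <= #|u.2|%:Z.
Proof.
elim: i => [|i ih] le_ik q_gt0.
  exists [:: (0%MM, setT)] => [b|u].
    rewrite /= initial_mon0 addn0; apply/eqP; rewrite eqb1.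
    by apply/in_blockP => l /=; rewrite mnm0E inE.
  rewrite inE => /eqP -> /=; rewrite big_pred0 // cardsT card_ord; lia.
have [s partS le_s] := ih (ltnW le_ik) (fun j lt_ji => q_gt0 j (ltnW lt_ji)).
pose i' := Ordinal le_ik.
have [nf] := ideal_coordinates (Q i').
have [t partT le_t] := sdepth_partition nf (q_gt0 i' (ltnSn i)).
exists (flatten [seq block_meet u v | u <- s, v <- t]).
  by move=> b; rewrite (initial_mon_rec i') (partitions_meet partS partT).
have le_tZ v : v \in t -> (q i')%:Z <= #|v.2|%:Z by move/le_t.
move=> u /(card_meet_blocks le_s le_tZ).
rewrite (sum_initial _ i') /=; move: (\sum_(j < k | _) _) #|u.2| (q i') => x y z; lia.
Qed.

(** The complement of an intersection is filtered by the first ideal that a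
    monomial misses. *)
Lemma complement_partition (e : int) i : (i <= k)%N ->
  (forall j, is_primary (Q j)) ->
  (forall j : 'I_k, (j.+1 < i)%N -> (0 < q j)%N) ->
  (forall l : 'I_k, (l < i)%N ->
    e <= \sum_(j < k | (j < l)%N) (q j)%:Z - #|ideal_vars (radical (Q l))|%:Z
           - n%:Z * ((l : nat)%:Z - 1)) ->
  exists2 s, partitions (fun b => ~~ initial_mon i b) s &
    forall u, u \in s -> e <= #|u.2|%:Z.
Proof.
move=> + prim; elim: i => [|i ih] le_ik q_gt0 le_e.
  by exists [::] => // b; rewrite initial_mon0.
have [|||s partS le_s] := ih; first exact: ltnW.
- by move=> j lt_ji; apply: q_gt0; apply: ltnW.
- by move=> l lt_li; apply: le_e; apply: ltnW.
pose i' := Ordinal le_ik.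
have [r partR le_r] := initial_partition (ltnW le_ik) (fun j => q_gt0 j).
have [t partT eq_t] := primary_complement_partition (prim i').
exists (s ++ flatten [seq block_meet u v | u <- r, v <- t]) => [b|u].
  rewrite count_cat partS (partitions_meet partR partT) (initial_mon_rec i') /=.
  by case: (initial_mon i b).
rewrite mem_cat => /orP[/le_s //|].
have le_tZ v : v \in t -> n%:Z - #|ideal_vars (radical (Q i'))|%:Z <= #|v.2|%:Z.
  move=> /eq_t ->; have := cardsC (ideal_vars (radical (Q i'))); rewrite card_ord.
  by move: #|_| #|_| => x y; lia.
move=> /(card_meet_blocks le_r le_tZ); apply: le_trans.
by apply: le_trans (le_e i' (ltnSn i)) _; move: (\sum_(j < k | _) _) => x /=; lia.
Qed.

End Intersections.
End Bridge.

(** * Bounds for the Stanley depth *)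

Theorem corollary2p14 (K : fieldType) (n k : nat) (hk : (0 < k)%N)
    (I : monomialIdeal K n) (Q : 'I_k -> monomialIdeal K n)
    (hI : exists2 f : {mpoly K[n]}, f \in (I : idealr {mpoly K[n]}) & f != 0)
    (hQ : irredundant_primary_decomposition I Q)
    (hd : forall i j : 'I_k, (i <= j)%N ->
       (#|ideal_vars (radical (Q j))| <= #|ideal_vars (radical (Q i))|)%N) :
  let q : 'I_k -> nat := fun j => sdepth (ideal_module (Q j)) in
  let d : 'I_k -> nat := fun j => #|ideal_vars (radical (Q j))| in
  let d1 : nat := d (Ordinal hk) in
  (* indices start at 0, so that i - 1 here is i - 2 in the 1-based formula *)
  let term : 'I_k -> int := fun i =>
    \sum_(j < k | (j < i)%N) (q j)%:Z - (d i)%:Z - n%:Z * ((i : nat)%:Z - 1) in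
  (\sum_(j < k) (q j)%:Z - n%:Z * (k%:Z - 1) <= (sdepth (ideal_module I))%:Z
     /\ (sdepth (ideal_module I))%:Z <= n%:Z - (d1 %/ 2)%:Z) /\
  (\big[Num.min/n%:Z - d1%:Z]_(i < k) term i
       <= (sdepth (quotient_module I))%:Z
     /\ (sdepth (quotient_module I))%:Z <= n%:Z - d1%:Z).
Proof.
move=> q d d1 term.
have d1_le : (d1 <= n)%N by rewrite /d1 /d -[leqRHS]card_ord max_card.
have q_le j : (q j <= n)%N by exact: sdepth_le.
have [primQ decI _ _] := hQ.
have initialE b : initial_mon Q k b = ('X_[b] \in (I : idealr {mpoly K[n]})).
  apply/forallP/idP => [all_in|/decI all_in j]; last by rewrite all_in implybT.
  by apply/decI => j; apply: (implyP (all_in j)).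
have [b [nb corner]] := irredundant_corner (Ordinal hk) hQ.
have [nfI] := ideal_coordinates I; have [nfQ] := quotient_coordinates I.
split; split.
- have sumE : \sum_(j < k) (q j)%:Z = \sum_(j < k | (j < k)%N) (q j)%:Z.
    by apply: eq_bigl => j; rewrite ltn_ord.
  have [/existsP[j /eqP qj0]|] := boolP [exists j, q j == 0%N].
    rewrite sumE (le_trans _ (_ : 0 <= _)) // subr_le0.
    exact: (sum_initial_zero _ (ltn_ord j)).
  rewrite negb_exists => /forallP q_gt0.
  have [s partS le_s] := @initial_partition _ _ _ Q k (leqnn k)
    (fun j _ => etrans (lt0n _) (q_gt0 j)).
  have [f fI] := hI; rewrite -msupp_eq0; case E: (msupp f) => [//|a r] _.
  apply: (le_sdepth_partition nfI (s := s) (b := a)) => [c||u /le_s].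
  + by rewrite partS initialE.
  + by apply: (monomial_ideal_msupp fI); rewrite E mem_head.
  + by rewrite sumE.
- have [->|sd_gt0] := posnP (sdepth (ideal_module I)).
    by rewrite subr_ge0 lez_nat (leq_trans (leq_div _ _)).
  have [s partS le_s] := sdepth_partition nfI sd_gt0.
  have := corner_bound partS nb corner le_s (sdepth_le _).
  by rewrite -/(d (Ordinal hk)) -/d1; move: (sdepth _) (d1 %/ 2)%N => x y; lia.
- have [/existsP[j /andP[lt_jk /eqP qj0]]|] :=
    boolP [exists j : 'I_k, (j.+1 < k)%N && (q j == 0%N)].
    apply: (le_trans (bigmin_le _ (Ordinal lt_jk) _)).
    have := @sum_initial_zero n k q j j.+1 (ltnW lt_jk) (ltnSn j) q_le qj0.
    by rewrite /term /=; move: (\sum_(l < k | _) _) (d _) => x y; lia.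
  rewrite negb_exists => /forallP q_gt0.
  have [|l _|s partS le_s] := @complement_partition _ _ _ Q
      (\big[Num.min/n%:Z - d1%:Z]_(i < k) term i) k (leqnn k) primQ.
  + by move=> j lt_jk; move: (q_gt0 j); rewrite lt_jk /= -lt0n.
  + exact: bigmin_le.
  apply: (le_sdepth_partition nfQ (s := s) _ nb) => // c.
  by rewrite partS initialE.
have [->|sd_gt0] := posnP (sdepth (quotient_module I)).
  by rewrite subr_ge0 lez_nat.
have [s partS le_s] := sdepth_partition nfQ sd_gt0.
have [u us] : exists2 u, u \in s & (#|u.2| + d1 <= n)%N.
  by apply: (block_avoids partS nb) => i /corner ->.
by have := le_s u us; move: (sdepth _) #|u.2| => x y; lia.
Qed.
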